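(* For every integer $n\geq 2$ there exists a constant $C_n$, depending only on $n$, such that the following holds. Let $\mathbb{F}$ be a field and let $\mathfrak{L}$ be a finite collection of $L$ lines in $\mathbb{F}^n$ such that, whenever $n$ lines of $\mathfrak{L}$ meet at a point, they form a joint there (i.e. their directions span $\mathbb{F}^n$). Let $J$ be the set of joints formed by $\mathfrak{L}$. Then $$\sum_{x\in J} N(x)^{\frac{1}{n-1}}\leq C_n\cdot \log L\cdot L^{\frac{n}{n-1}}.$$
   Context: A collection of lines is a set of distinct lines. A line in $\mathbb{F}^n$ is a set $\{v+tb : t\in\mathbb{F}\}$ with $v,b\in\mathbb{F}^n$, $b\neq 0$; $b$ is its direction. A joint formed by $\mathfrak{L}$ is a point of $\mathbb{F}^n$ lying in at least $n$ lines of $\mathfrak{L}$ whose directions span $\mathbb{F}^n$. The multiplicity $N(x)$ of a joint $x$ is the number of (unordered) $n$-tuples of lines of $\mathfrak{L}$ through $x$ whose directions span $\mathbb{F}^n$. *)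

(* Defs.v *)
From mathcomp Require Import all_boot all_order all_algebra.
From mathcomp Require Import finmap.
From mathcomp Require Import all_classical all_reals all_analysis.
Set Implicit Arguments. Unset Strict Implicit. Unset Printing Implicit Defensive.
Import Order.TTheory GRing.Theory Num.Theory.
Local Open Scope fset_scope.
Local Open Scope classical_set_scope.
Local Open Scope ring_scope.

Section Joints.
Context {F : fieldType} {n : nat}.
Implicit Types (v b x : 'rV[F]_n) (l : set 'rV[F]_n).
Implicit Types (S LL : {fset set 'rV[F]_n}).

Definition line_through v b : set 'rV[F]_n := [set v + t *: b | t in [set: F]].

Definition is_direction l b : Prop :=
  b != 0 /\ exists v, l = line_through v b.

Definition is_line l : Prop := exists b, is_direction l b.

Definition meet_at S x : Prop := forall l, l \in S -> l x.

(* A direction of a line is unique up to a nonzero scalar, so the span does not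
   depend on the choice d of one direction for each line of S. *)
Definition directions_span S : Prop :=
  exists2 d : set 'rV[F]_n -> 'rV[F]_n,
    (forall l, l \in S -> is_direction l (d l)) &
    <<[seq d l | l <- enum_fset S]>>%VS = fullv.

Definition joint_set LL : set 'rV[F]_n :=
  [set x | exists S, [/\ (S `<=` LL)%fset, (n <= #|` S|)%N, meet_at S x &
                         directions_span S]].

(* Unordered n-tuples are n-element subsets: n lines whose directions span F^n
   are necessarily distinct. *)
Definition multiplicity LL x : nat :=
  #|` [fset S in fpowerset LL |
        [&& #|` S| == n, `[< meet_at S x >] & `[< directions_span S >]]]%fset|.

Lemma line_throughE l x y :
  is_line l -> l x -> l y -> x != y -> l = line_through x (y - x).
Proof.
move=> [b [b0 [v ->]]] [t _ <-] [s _ <-] xy.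
have st : s - t != 0.
  by apply: contra xy; rewrite subr_eq0 => /eqP ->.
have -> : v + s *: b - (v + t *: b) = (s - t) *: b.
  by rewrite opprD addrACA subrr add0r scalerBl.
apply/seteqP; split => z [u _ <-].
  exists ((u - t) / (s - t)) => //.
  by rewrite scalerA divfK // -addrA -scalerDl [t + _]addrC subrK.
by exists (t + u * (s - t)) => //; rewrite scalerDl scalerA addrA.
Qed.

(* Makes the finitely supported sum over joint_set LL a genuine sum: that
   operator returns 0 on an infinite support. *)
Lemma finite_joint_set LL : (1 < n)%N -> finite_set (joint_set LL).
Proof.
move=> n1.
pose I (p : set 'rV[F]_n * set 'rV[F]_n) : set 'rV[F]_n :=
  [set x | [/\ p.1 != p.2, is_line p.1, is_line p.2, p.1 x & p.2 x]].
have finI p : finite_set (I p).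
  have [[x Ix]|noI] := pselect (exists x, I p x); last first.
    suff -> : I p = set0 by exact: finite_set0.
    by apply/seteqP; split => // x Ix; apply: noI; exists x.
  apply: (@sub_finite_set _ _ [set x]); last exact: finite_set1.
  move=> y [_ _ _ y1 y2] /=; case: Ix => p12 L1 L2 x1 x2.
  apply/eqP/negPn/negP => yx; move/negP: p12; apply; apply/eqP.
  by rewrite (line_throughE L1 y1 x1 yx) (line_throughE L2 y2 x2 yx).
have : finite_set (\bigcup_(p in [set` (LL `*` LL)%fset]) I p).
  by apply: bigcup_finite => // p _; exact: finI.
apply: sub_finite_set => x [S [SL nS Sx [d dS _]]].
have [l [m [lS mS lm]]] : exists l m, [/\ l \in S, m \in S & l != m].
  have := leq_trans n1 nS; rewrite cardfE => /card_gt1P[l [m [_ _ lm]]].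
  by exists (val l), (val m); split; [exact: valP | exact: valP | ].
exists (l, m) => /=.
  by rewrite in_fsetM /= (fsubsetP SL _ lS) (fsubsetP SL _ mS).
by split => //=; [exists (d l); exact: dS | exists (d m); exact: dS
                 | exact: Sx | exact: Sx].
Qed.

End Joints.

(* Main.v *)
(* The polynomial method bounds the number |J| of joints: if every line carried
   more joints than the degree of some nonzero polynomial vanishing on J, such a
   polynomial of minimal degree would vanish on every line, hence so would its
   gradient at every joint. So some line carries few joints, and removing such
   lines one by one gives |J|^(n-1) <= (n L)^n. Keeping a random proportion of
   about 1/k of the lines, a point on at least k lines still has n of them
   with probability at least 1/2 and, by genericity, is still a joint; so the set
   J_k of such points satisfies |J_k|^(n-1) k^n <= C L^n. Since N(x) <= r^n when
   r lines pass through x, each dyadic range of r contributes at most a constant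
   times L^(n/(n-1)), and about log L ranges occur. *)
From mathcomp Require Import all_boot all_order all_algebra.
From mathcomp Require Import zify.
From mathcomp Require mpoly.
Set Implicit Arguments. Unset Strict Implicit. Unset Printing Implicit Defensive.
Import Order.TTheory GRing.Theory Num.Theory.

(** * Random subsets, by counting colourings *)

Section Sampling.
Context {T : finType} (m : nat).
Implicit Types (A B : {set T}) (f : {ffun T -> 'I_m.+1}).

(** Under a uniformly random colouring by [m.+1] colours, each point gets colour 0 independently
    with probability 1 / (m + 1). These points form the random sample; probabilities become counts
    of colourings. *)
Definition colour0 f : {set T} := [set x | f x == ord0].

Lemma card_colourings (Q : T -> pred 'I_m.+1) :
  #|[set f : {ffun T -> 'I_m.+1} | [forall x, Q x (f x)]]| = \prod_x #|Q x|.
Proof.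
rewrite (eq_card (B := family Q)); last first.
  by move=> f; rewrite inE; apply/forallP/familyP.
by rewrite card_family foldrE big_map big_enum.
Qed.

Lemma card_ffun_colours : #|{ffun T -> 'I_m.+1}| = m.+1 ^ #|T|.
Proof. by rewrite card_ffun card_ord. Qed.

Lemma card_colour0_at x :
  m.+1 * #|[set f : {ffun T -> 'I_m.+1} | x \in colour0 f]| = m.+1 ^ #|T|.
Proof.
pose Q y : pred 'I_m.+1 := fun c => (y == x) ==> (c == ord0).
have -> : [set f : {ffun T -> 'I_m.+1} | x \in colour0 f] =
    [set f : {ffun T -> 'I_m.+1} | [forall y, Q y (f y)]].
  apply/setP => f; rewrite !inE; apply/idP/forallP => [fx y|/(_ x)].
    by apply/implyP => /eqP ->.
  by rewrite /Q eqxx.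
rewrite (card_colourings Q) (bigD1 x) //= (eq_card1 (x := ord0)); last first.
  by move=> c; rewrite [LHS]unfold_in /= /Q eqxx inE.
rewrite mul1n (eq_bigr (fun => m.+1)) => [|y yx]; last first.
  by rewrite -[RHS](card_ord m.+1); apply: eq_card => c; rewrite unfold_in /= /Q (negPf yx).
rewrite prod_nat_const -expnS; congr (_ ^ _).
have -> : #|[pred i | i != x]| = #|T|.-1 by rewrite -(cardC1 x); apply: eq_card.
by rewrite prednK //; apply/card_gt0P; exists x.
Qed.

(** This is (1 - 1 / (m + 1)) ^ (m + 1) <= 1/2, from the first two terms of the binomial expansion
    of (m + 1) ^ (m + 1). *)
Lemma doubling_expn : 2 * m ^ m.+1 <= m.+1 ^ m.+1.
Proof.
case: (posnP m) => [->|m0]; first by rewrite exp0n.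
have b k : m ^ k + k * m ^ k.-1 <= m.+1 ^ k.
  elim: k => // k IH; rewrite expnS [m.+1 ^ _]expnS.
  case: k IH => [|k] /= IH; first by lia.
  have := leq_mul (leqnn m.+1) IH; rewrite !expnS /=; nia.
by apply: leq_trans (b m.+1); rewrite /= expnS; lia.
Qed.

(** A group of m + 1 points misses colour 0 with probability at most 1/2, and the block amounts to n
    such groups. *)
Lemma card_miss_block n B : #|B| = n * m.+1 ->
  2 ^ n * #|[set f : {ffun T -> 'I_m.+1} | [disjoint B & colour0 f]]| <= m.+1 ^ #|T|.
Proof.
move=> sB; pose Q y : pred 'I_m.+1 := fun c => (y \in B) ==> (c != ord0).
have -> : [set f : {ffun T -> 'I_m.+1} | [disjoint B & colour0 f]] =
    [set f : {ffun T -> 'I_m.+1} | [forall y, Q y (f y)]].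
  apply/setP => f; rewrite !inE; apply/pred0P/forallP => [fB y|fB y].
    by have /= := fB y; rewrite /Q inE; case: (y \in B) => //= ->.
  by have /= := fB y; rewrite /Q inE; case: (y \in B) => //= /negPf.
rewrite (card_colourings Q) (bigID (mem B)) /=.
rewrite (eq_bigr (fun => m)) => [|y yB]; last first.
  rewrite -[RHS](congr1 predn (card_ord m.+1)) -(cardC1 ord0).
  by apply: eq_card => c; rewrite !inE [LHS]unfold_in /= /Q yB.
rewrite [X in _ * (_ * X)](eq_bigr (fun => m.+1)) => [|y yB]; last first.
  by rewrite -[RHS](card_ord m.+1); apply: eq_card => c; rewrite unfold_in /= /Q (negPf yB).
rewrite !prod_nat_const.
have -> : #|[pred i | i \notin B]| = #|T| - #|B|.
  by rewrite -(cardC B) addKn; apply: eq_card.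
rewrite mulnA -[X in _ <= m.+1 ^ X](subnKC (max_card (mem B))) expnD leq_mul2r.
rewrite sB [n * _]mulnC !expnM -expnMn; apply/orP; right.
by case: n {sB} => // n; rewrite leq_exp2r // doubling_expn.
Qed.

Lemma exists_injection (X : finType) A : #|X| <= #|A| ->
  exists h : X -> T, injective h /\ forall p, h p \in A.
Proof.
move=> XA; exists (fun p => enum_val (widen_ord XA (enum_rank p))).
split=> [p q /enum_val_inj /(congr1 val) /= /ord_inj /enum_rank_inj //|p].
exact: enum_valP.
Qed.

(* Cut A into n blocks of size n * (m + 1); a given block contains no point of
   colour 0 with probability at most 2 ^ (- n) <= 1 / (2 n). *)
Lemma card_few_colour0 n A : 0 < n -> n * (n * m.+1) <= #|A| ->
  2 * #|[set f : {ffun T -> 'I_m.+1} | #|A :&: colour0 f| < n]| <= m.+1 ^ #|T|.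
Proof.
move=> n0 sA; have [|h [hinj hA]] := @exists_injection ('I_n * 'I_(n * m.+1))%type A.
  by rewrite card_prod !card_ord.
pose B i := [set h (i, j) | j : 'I_(n * m.+1)].
have cB i : #|B i| = n * m.+1 by rewrite card_imset ?card_ord // => j k /hinj [].
pose miss i := [set f : {ffun T -> 'I_m.+1} | [disjoint B i & colour0 f]].
have sub : [set f : {ffun T -> 'I_m.+1} | #|A :&: colour0 f| < n] \subset
    \bigcup_i miss i.
  apply/subsetP => f; rewrite inE; apply: contraLR => fmiss; rewrite -leqNgt.
  have hit i : exists j, h (i, j) \in colour0 f.
    have : f \notin miss i by apply: contra fmiss => fi; apply/bigcupP; exists i.
    by rewrite inE => /pred0Pn[_ /andP[/imsetP[j _ ->] ?]]; exists j.
  pose g i := h (i, xchoose (hit i)).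
  have ginj : injective g by move=> i k /hinj [].
  rewrite -[X in X <= _](card_ord n) -(card_imset _ ginj); apply: subset_leq_card.
  apply/subsetP => _ /imsetP[i _ ->]; rewrite inE hA.
  exact: (xchooseP (hit i)).
have bound : 2 ^ n * #|[set f : {ffun T -> 'I_m.+1} | #|A :&: colour0 f| < n]| <=
    n * m.+1 ^ #|T|.
  apply: leq_trans (leq_mul (leqnn _) (subset_leq_card sub)) _.
  have cU : #|\bigcup_i miss i| <= \sum_i #|miss i|.
    apply: (big_ind2 (fun (U : {set {ffun T -> 'I_m.+1}}) k => #|U| <= k)) => //.
      by rewrite cards0.
    by move=> U1 k1 U2 k2 u1 u2; apply: leq_trans (leq_card_setU _ _) (leq_add u1 u2).
  apply: leq_trans (leq_mul (leqnn _) cU) _.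
  rewrite big_distrr /= -[X in X * _](card_ord n) -sum_nat_const.
  by apply: leq_sum => i _; apply: card_miss_block.
have n2 : 2 * n <= 2 ^ n.
  by case: n n0 {sA h hinj hA B cB miss sub bound} => // n _; rewrite expnS leq_mul2l ltn_expl.
rewrite -(leq_pmul2l n0) mulnA [n * 2]mulnC; apply: leq_trans bound.
by rewrite leq_mul2r n2 orbT.
Qed.

(** Markov's inequality: the mean number of points of colour 0 is |T| / (m + 1). *)
Lemma card_large_colour0 :
  4 * #|[set f : {ffun T -> 'I_m.+1} | 4 * #|T| < m.+1 * #|colour0 f|]| <= m.+1 ^ #|T|.
Proof.
set H := [set f | _].
have sum0 : m.+1 * \sum_(f : {ffun T -> 'I_m.+1}) #|colour0 f| = #|T| * m.+1 ^ #|T|.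
  under eq_bigr do rewrite -sum1_card.
  rewrite (exchange_big_dep predT) //= big_distrr /= -sum_nat_const.
  apply: eq_bigr => x _; rewrite sum1_card -(card_colour0_at x); congr (_ * _).
  by apply: eq_card => f; rewrite -[LHS]/(x \in colour0 f) !inE.
have Hsum : (4 * #|T|).+1 * #|H| <= #|T| * m.+1 ^ #|T|.
  rewrite -sum0 mulnC -sum_nat_const big_distrr /= [leqRHS](bigID (mem H)) /=.
  apply: leq_trans (leq_addr _ _); apply: leq_sum => f; by rewrite inE.
case: (posnP #|T|) Hsum => [-> | T0 Hsum]; first by rewrite muln0 mul1n mul0n leqn0 => /eqP ->.
by rewrite -(leq_pmul2l T0); lia.
Qed.

(** The sample is too large with probability at most 1/4, and a given [x] keeps fewer than n points
    of [inc x] with probability at most 1/2. In the application [inc x] is the set of lines through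
    the point [x]. *)
Lemma exists_sample (J : finType) (inc : J -> {set T}) n :
    0 < n -> (forall x, n * (n * m.+1) <= #|inc x|) ->
  exists S : {set T}, m.+1 * #|S| <= 4 * #|T| /\
    #|J| <= 4 * #|[set x | n <= #|inc x :&: S|]|.
Proof.
move=> n0 incn; pose H := [set f : {ffun T -> 'I_m.+1} | 4 * #|T| < m.+1 * #|colour0 f|].
pose bad f := [set x | #|inc x :&: colour0 f| < n].
have [/existsP[f /andP[fH fJ]]|/existsPn noS] :=
    boolP [exists f, (f \notin H) && (4 * #|bad f| <= 3 * #|J|)].
  exists (colour0 f); split; first by move: fH; rewrite inE -leqNgt.
  have -> : [set x | n <= #|inc x :&: colour0 f|] = ~: bad f.
    by apply/setP => x; rewrite !inE -leqNgt.
  by have := cardsC (bad f); lia.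
(* Otherwise every colouring outside [H], hence at least 3/4 of them, leaves more than 3/4 of [J]
   bad; the mean of [#|bad f|] then exceeds 9/16 of [#|J|], against the bound 1/2. *)
have badsum : 2 * \sum_(f : {ffun T -> 'I_m.+1}) #|bad f| <= #|J| * m.+1 ^ #|T|.
  under eq_bigr do rewrite -sum1_card.
  rewrite (exchange_big_dep predT) //= big_distrr /= -sum_nat_const.
  apply: leq_sum => x _; rewrite sum1_card.
  apply: leq_trans (card_few_colour0 n0 (incn x)); rewrite leq_mul2l /=.
  by apply: eq_leq; apply: eq_card => f; rewrite -[LHS]/(x \in bad f) !inE.
have badH : (3 * #|J|).+1 * #|~: H| <= 4 * \sum_(f : {ffun T -> 'I_m.+1}) #|bad f|.
  rewrite mulnC -sum_nat_const big_distrr /= [leqRHS](bigID (mem H)) /=.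
  apply: leq_trans (leq_addl _ _).
  rewrite (eq_bigl [pred f | f \notin H]) => [|f]; last by rewrite in_setC.
  by apply: leq_sum => f /= fH; move: (noS f); rewrite (fH : f \notin H) /= -ltnNge.
have := card_large_colour0; rewrite -/H => H4.
have := cardsC H; rewrite card_ffun_colours => HN.
have N0 : 0 < m.+1 ^ #|T| by rewrite expn_gt0.
by exfalso; nia.
Qed.

End Sampling.

Local Open Scope ring_scope.

Module PolynomialMethod.
Import mpoly.

(** * Restriction of a polynomial to a line *)

Section LineRestriction.
Context {F : fieldType} {n : nat}.
Implicit Types (P : {mpoly F[n]}) (x b : 'rV[F]_n).

Definition mpoly_at P x : F := P.@[x 0].

Definition line_coord x b (i : 'I_n) : {poly F} := (x 0 i)%:P + b 0 i *: 'X.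

Definition line_restr x b P : {poly F} := mmap (@polyC F) (line_coord x b) P.

Lemma horner_line_restr x b P t :
  (line_restr x b P).[t] = mpoly_at P (x + t *: b).
Proof.
rewrite /line_restr /mmap horner_sum /mpoly_at mevalE; apply: eq_bigr => m _.
rewrite hornerM hornerC; congr (_ * _).
rewrite /mmap1 horner_prod; apply: eq_bigr => i _.
by rewrite horner_exp hornerD hornerC hornerZ hornerX !mxE mulrC.
Qed.

Lemma size_line_restr x b P : (size (line_restr x b P) <= msize P)%N.
Proof.
rewrite /line_restr /mmap; apply: (leq_trans (size_sum _ _ _)).
apply/bigmax_leqP_seq => m mP _.
rewrite mul_polyC; apply: (leq_trans (size_scale_leq _ _)).
apply: leq_trans (msize_mdeg_lt mP).
rewrite mdegE /mmap1.
have sM (p q : {poly F}) k l : (size p <= k.+1 -> size q <= l.+1 ->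
    size (p * q)%R <= (k + l).+1)%N.
  move=> sp sq; apply: (leq_trans (size_polyMleq _ _)).
  by rewrite -subn1 leq_subLR add1n -addSn -addnS leq_add.
apply: (@big_ind2 _ _ (fun (p : {poly F}) k => (size p <= k.+1)%N)).
- by rewrite size_poly1.
- by move=> p k q l; apply: sM.
move=> i _; elim: (m i) => [|k IH]; first by rewrite expr0 size_poly1.
rewrite exprS -[k.+1]add1n; apply: sM IH.
apply: (leq_trans (size_polyD _ _)); rewrite geq_max.
rewrite (leq_trans (size_polyC_leq1 _)) //=.
by rewrite (leq_trans (size_scale_leq _ _)) // size_polyX.
Qed.

(** The chain rule along a line: it holds for 1 and the variables and passes to products, hence to
    monomials, then to all [P] by linearity. *)
Lemma deriv_line_restr x b P :
  (line_restr x b P)^`() = \sum_j b 0 j *: line_restr x b P^`M(j).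
Proof.
pose chain P := (line_restr x b P)^`() = \sum_j b 0 j *: line_restr x b P^`M(j).
have cM P1 P2 : chain P1 -> chain P2 -> chain (P1 * P2).
  rewrite /chain /line_restr => c1 c2; rewrite rmorphM derivM c1 c2.
  rewrite mulr_suml mulr_sumr -big_split; apply: eq_bigr => j _ /=.
  by rewrite mderivM rmorphD !rmorphM scalerDr -scalerAl -scalerAr.
have c1 : chain 1.
  rewrite /chain /line_restr rmorph1 derivC big1 // => j _.
  by rewrite mderivC mmap0 scaler0.
have cX i : chain 'X_i.
  rewrite /chain /line_restr mmapX mmap1U derivD derivC derivZ derivX add0r.
  rewrite (bigD1 i) //= big1 => [|j ji].
    rewrite mderivX mnmE eqxx -{1}[U_(i)%MM]add0m addmK mpolyX0 scale1r rmorph1 addr0.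
    by rewrite -[_ *: 1]/(_%:A) alg_polyC.
  by rewrite mderivX mnmE eq_sym (negPf ji) scale0r mmap0 scaler0.
elim/mpolyind: P => [|c m p _ _ IH].
  rewrite /line_restr mmap0 deriv0 big1 // => j _.
  by rewrite mderiv0 mmap0 scaler0.
have cm : chain 'X_[m].
  rewrite mpolyXE_id; apply: (big_ind chain) => // i _.
  by elim: (m i) => [|k IHk]; rewrite ?expr0 // exprS; apply: cM.
have LD p1 p2 : line_restr x b (p1 + p2) = line_restr x b p1 + line_restr x b p2.
  exact: mmapD.
have LZ a p1 : line_restr x b (a *: p1) = a *: line_restr x b p1.
  by rewrite /line_restr mmapZ mul_polyC.
rewrite LD LZ derivD derivZ cm IH scaler_sumr.
rewrite -big_split; apply: eq_bigr => j _ /=.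
by rewrite mderivD mderivZ LD LZ scalerDr !scalerA mulrC.
Qed.

(** The restriction to the line has too many roots for its degree, so it is the zero polynomial; so
    is its formal derivative, whose value at 0 is the directional derivative. *)
Lemma directional_deriv_eq0 P x b (s : seq F) :
    uniq s -> (msize P <= size s)%N ->
    (forall t, t \in s -> mpoly_at P (x + t *: b) = 0) ->
  \sum_j b 0 j * mpoly_at P^`M(j) x = 0.
Proof.
move=> us sP Ps; have r0 : line_restr x b P = 0.
  apply: contraTeq sP => r0.
  rewrite -ltnNge; apply: leq_trans (size_line_restr x b P).
  apply: max_poly_roots => //; apply/allP => t /Ps.
  by rewrite -horner_line_restr => /eqP.
have := congr1 (fun p => p^`().[0]) r0.
rewrite deriv0 horner0 deriv_line_restr horner_sum => s0.
rewrite -[RHS]s0; apply: eq_bigr => j _.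
by rewrite hornerZ horner_line_restr scale0r addr0.
Qed.

End LineRestriction.

(** * Vanishing polynomials by linear algebra *)

Section MonomialMatrix.
Context {F : fieldType} {n : nat}.
Variable k : nat.
Implicit Types (J : seq 'rV[F]_n).

Definition poly_of_row (u : 'rV[F]_#|{: 'X_{1..n < k}}|) : {mpoly F[n]} :=
  \sum_i u 0 i *: 'X_[bmnm (enum_val i)].

(** Rows are the monomials of degree below [k], columns the points of [J]: the left kernel is the
    space of such polynomials vanishing on [J]. *)
Definition monomial_mx J : 'M[F]_(#|{: 'X_{1..n < k}}|, size J) :=
  \matrix_(i, j) mpoly_at 'X_[bmnm (enum_val i)] (nth 0 J j).

Lemma mpoly_at_poly_of_row J u (j : 'I_(size J)) :
  mpoly_at (poly_of_row u) (nth 0 J j) = (u *m monomial_mx J) 0 j.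
Proof.
rewrite mxE /mpoly_at /poly_of_row raddf_sum; apply: eq_bigr => i _.
by rewrite /= mevalZ mxE.
Qed.

Lemma mcoeff_poly_of_row u i : (poly_of_row u)@_(bmnm (enum_val i)) = u 0 i.
Proof.
rewrite /poly_of_row raddf_sum (bigD1 i) //= mcoeffZ mcoeffX eqxx mulr1.
rewrite big1 ?addr0 // => j ji; rewrite mcoeffZ mcoeffX.
by rewrite -bmeqP (inj_eq enum_val_inj) (negPf ji) mulr0.
Qed.

Lemma poly_of_row_eq0 u : poly_of_row u = 0 -> u = 0.
Proof.
by move=> u0; apply/rowP => i; rewrite -mcoeff_poly_of_row u0 mcoeff0 mxE.
Qed.

Lemma msize_poly_of_row u : (msize (poly_of_row u) <= k)%N.
Proof.
rewrite /poly_of_row.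
apply: (big_ind (fun P : {mpoly F[n]} => msize P <= k)%N).
- by rewrite msize0.
- move=> P Q sP sQ; apply: (leq_trans (mmeasureD_le _ _ _)).
  by rewrite geq_max sP.
move=> i _; apply: (leq_trans (msizeZ_le _ _)).
by rewrite msizeX bmdeg.
Qed.

Lemma exists_vanishing_poly J : (size J < #|{: 'X_{1..n < k}}|)%N ->
  exists P : {mpoly F[n]},
    [/\ P != 0, (msize P <= k)%N & forall x, x \in J -> mpoly_at P x = 0].
Proof.
move=> sJ; have : kermx (monomial_mx J) != 0.
  rewrite kermx_eq0 /row_free neq_ltn.
  by rewrite (leq_ltn_trans (rank_leq_col _) sJ).
case/rowV0Pn => u /sub_kermxP uJ u0; exists (poly_of_row u); split.
- by apply: contraNneq u0 => /poly_of_row_eq0 ->.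
- exact: msize_poly_of_row.
move=> x xJ; have xs : (index x J < size J)%N by rewrite index_mem.
have := mpoly_at_poly_of_row u (Ordinal xs).
by rewrite nth_index // => ->; rewrite uJ mxE.
Qed.

End MonomialMatrix.

(** * Polynomials vanishing along spanning directions *)

Lemma spanning_functional_eq0 (F : fieldType) (n : nat) (B : seq 'rV[F]_n)
    (g : 'I_n -> F) :
    <<B>>%VS = fullv -> (forall b, b \in B -> \sum_j b 0 j * g j = 0) ->
  forall j, g j = 0.
Proof.
move=> Bfull Bg j; pose f := linfun (mulmxr (\col_j g j) : 'rV[F]_n -> 'cV[F]_1).
have fE v : f v 0 0 = \sum_j v 0 j * g j.
  by rewrite lfunE /= mxE; apply: eq_bigr => i _; rewrite mxE.
have : (fullv <= lker f)%VS.
  rewrite -Bfull; apply/span_subvP => b /Bg; rewrite -fE memv_ker => fb.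
  by apply/eqP/rowP => i; rewrite ord1 fb mxE.
move/subvP/(_ (delta_mx 0 j) (memvf _)); rewrite memv_ker => /eqP/rowP/(_ 0).
rewrite fE mxE (bigD1 j) //= mxE !eqxx mul1r big1 ?addr0 // => i ij.
by rewrite mxE (negPf ij) mul0r.
Qed.

(** When all partial derivatives of [P] vanish, this forces every exponent occurring in [P] to be
    zero in [F]. *)
Lemma mcoeff_eq0_of_mderiv (F : fieldType) (n : nat) (P : {mpoly F[n]}) m i :
  P^`M(i) = 0 -> P@_m * (m i)%:R = 0.
Proof.
move=> dP; case: (posnP (m i)) => [-> | mi]; first by rewrite mulr0.
have mE : ((m - U_(i)) + U_(i) = m)%MM.
  by rewrite submK //; apply/mnm_lepP => j; rewrite mnm1E; case: eqP => // <-.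
have := mcoeff_mderiv i P (m - U_(i))%MM; rewrite dP mcoeff0 mE => /esym.
by rewrite mnmBE mnm1E eqxx subn1 prednK // mulr_natr.
Qed.

(* When all partial derivatives of P vanish in characteristic p, P is a
   polynomial in the p-th powers of the variables; since F need not be perfect,
   P need not itself be a p-th power. Frobenius preserves the rank of the
   monomial matrix, which replaces taking a p-th root. *)
Lemma vanishing_poly_eq0 (F : fieldType) (n d : nat) (J : seq 'rV[F]_n) :
    J != [::] ->
    (forall x, x \in J -> exists2 B : seq 'rV[F]_n, <<B>>%VS = fullv &
       forall b, b \in B -> exists s : seq F,
         [/\ uniq s, (d < size s)%N & forall t, t \in s -> x + t *: b \in J]) ->
  forall P : {mpoly F[n]}, (msize P <= d.+1)%N ->
    (forall x, x \in J -> mpoly_at P x = 0) -> P = 0.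
Proof.
move=> J0 HJ; suff H k : (k <= d.+1)%N -> forall P : {mpoly F[n]},
    (msize P <= k)%N -> (forall x, x \in J -> mpoly_at P x = 0) -> P = 0.
  exact: H (leqnn _).
elim: k => [|k IH] kd P Pk PJ; first by apply/eqP; rewrite -msize_poly_eq0 -leqn0.
have {}IH := IH (ltnW kd).
(* Each partial derivative has smaller size. It vanishes on [J], because the directional derivatives
   of [P] vanish along a spanning family; so it is zero by induction. *)
have dP i : P^`M(i) = 0.
  apply: IH => [|x xJ].
    rewrite msizeE; apply/bigmax_leqP_seq => m mP _.
    move: mP; rewrite mcoeff_msupp mcoeff_mderiv => mP.
    have mP' : (m + U_(i))%MM \in msupp P.
      by rewrite mcoeff_msupp; apply: contraNneq mP => ->; rewrite mul0rn.
    rewrite -ltnS; apply: leq_trans Pk; have := msize_mdeg_lt mP'.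
    by rewrite mdegD mdeg1 addn1.
  have [B Bfull HB] := HJ _ xJ.
  apply: (spanning_functional_eq0 (g := fun i => mpoly_at P^`M(i) x)) Bfull _ i.
  move=> b /HB[s [us ds sJ]]; apply: (directional_deriv_eq0 us).
    exact: leq_trans (leq_trans Pk kd) ds.
  by move=> t /sJ /PJ.
have [P1|P1] := leqP (msize P) 1.
  rewrite (msize1_polyC P1); case: J J0 PJ {HJ IH} => // x J _ PJ.
  have := PJ x (mem_head _ _); rewrite {1}(msize1_polyC P1) /mpoly_at mevalC.
  by move=> ->; rewrite mpolyC0.
have Pm m i : m \in msupp P -> (m i)%:R = 0 :> F.
  rewrite mcoeff_msupp => /negPf mP; apply/eqP.
  by have /eqP := mcoeff_eq0_of_mderiv m (dP i); rewrite mulf_eq0 mP.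
have P0 : P != 0 by apply: contraTneq P1 => ->; rewrite msize0.
have [i mi] : exists i, (0 < mlead P i)%N.
  apply/existsP; apply: contraLR P1 => /existsPn m0.
  rewrite -leqNgt -mlead_deg // mdegE big1 // => i _; apply/eqP.
  by have := m0 i; rewrite lt0n negbK.
have [p pcharFp] : exists p, p \in [pchar F].
  by apply: (natf0_pchar mi); rewrite (Pm _ _ (mlead_supp P0)).
have dvdpm m j : m \in msupp P -> (p %| m j)%N.
  by move=> /(Pm _ j) mj; rewrite (dvdn_pcharf pcharFp) mj.
case: k => [|k] in kd Pk IH *; first by rewrite leqNgt P1 in Pk.
have p1 : (1 < p)%N by apply: prime_gt1; case/andP: pcharFp.
pose M := monomial_mx k.+1 J.
(* The induction hypothesis makes the rows of [M] independent, and the entrywise Frobenius preserves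
   this. *)
have Mfree : row_free M.
  apply: inj_row_free => u uM; apply: poly_of_row_eq0; apply: IH.
    exact: msize_poly_of_row.
  move=> x xJ; have xs : (index x J < size J)%N by rewrite index_mem.
  have := mpoly_at_poly_of_row u (Ordinal xs).
  by rewrite nth_index // => ->; rewrite uM mxE.
have Mpfree : row_free (map_mx (pFrobenius_aut pcharFp) M) by rewrite row_free_map.
(* All exponents are divisible by [p], so [P] is a combination of p-th powers of monomials; since p
   >= 2, these monomials have degree at most [k]. *)
pose a : 'rV[F]_#|{: 'X_{1..n < k.+1}}| := \row_i P@_(bmnm (enum_val i) *+ p).
have PE : P = \sum_i a 0 i *: 'X_[bmnm (enum_val i) *+ p].
  apply/mpolyP => m; rewrite raddf_sum /=.
  have [mP|] := boolP (m \in msupp P); last first.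
    rewrite mcoeff_msupp negbK => /eqP Pm0; rewrite Pm0 big1 // => j _.
    rewrite mcoeffZ mcoeffX mxE; case: eqP => [->|]; last by rewrite mulr0.
    by rewrite Pm0 mul0r.
  pose q := [multinom (m j %/ p)%N | j < n].
  have qm : (q *+ p)%MM = m.
    by apply/mnmP => j; rewrite mulmnE mnmE divnK // dvdpm.
  have qk : (mdeg q < k.+1)%N.
    have := leq_trans (msize_mdeg_lt mP) Pk.
    rewrite -qm mdegMn => qk; have := leq_mul (leqnn (mdeg q)) p1; lia.
  rewrite (bigD1 (enum_rank (BMultinom qk))) //= big1 => [|j jq].
    by rewrite addr0 mcoeffZ mcoeffX mxE enum_rankK /= qm eqxx mulr1.
  rewrite mcoeffZ mcoeffX; case: eqP => [jm|]; last by rewrite mulr0.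
  case/eqP: jq; apply: enum_val_inj; rewrite enum_rankK; apply/val_inj/mnmP => l /=.
  rewrite mnmE -jm mulmnE mulnK //; exact: ltnW.
(* The p-th power of a monomial takes Frobenius images as values, so the vanishing of [P] on [J]
   puts [a] in the left kernel of the Frobenius image of [M]. *)
have a0 : a = 0.
  apply: (row_free_inj Mpfree); rewrite mul0mx; apply/rowP => j; rewrite !mxE.
  have := PJ _ (mem_nth 0 (ltn_ord j)); rewrite {1}PE /mpoly_at raddf_sum => s0.
  rewrite -[RHS]s0; apply: eq_bigr => l _; rewrite /= mevalZ !mxE; congr (_ * _).
  rewrite pFrobenius_autE /mpoly_at !mevalX -prodrXl; apply: eq_bigr => h _.
  by rewrite mulmnE exprM.
by rewrite PE a0 big1 // => l _; rewrite mxE scale0r.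
Qed.

(** The monomials with every exponent at most [e] have degree at most n e, and there are (e + 1) ^ n
    of them. *)
Lemma leq_card_bmultinom n e :
  (e.+1 ^ n <= #|{: 'X_{1..n < (n * e).+1}}|)%N.
Proof.
have -> : (e.+1 ^ n)%N = #|{ffun 'I_n -> 'I_e.+1}| by rewrite card_ffun !card_ord.
have mk (f : {ffun 'I_n -> 'I_e.+1}) :
    (mdeg [multinom val (f i) | i < n] < (n * e).+1)%N.
  rewrite mdegE ltnS; under eq_bigr do rewrite mnmE.
  apply: (@leq_trans (\sum_(i < n) e)); first by apply: leq_sum => i _; exact: leq_ord.
  by rewrite sum_nat_const card_ord.
pose g f := BMultinom (mk f).
rewrite -(@card_codom _ _ g) ?max_card // => f h /(congr1 (@bmnm _ _)) /= fh.
apply/ffunP => i; apply/val_inj.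
by have := congr1 (fun m : 'X_{1..n} => m i) fh; rewrite !mnmE.
Qed.

(** So few points admit a nonzero polynomial of degree at most n e, which cannot survive more than n
    e zeros in each spanning direction. *)
Lemma rich_directions_false (F : fieldType) (n e : nat) (J : seq 'rV[F]_n) :
    J != [::] -> (size J < e.+1 ^ n)%N ->
  ~ (forall x, x \in J -> exists2 B : seq 'rV[F]_n, <<B>>%VS = fullv &
       forall b, b \in B -> exists s : seq F,
         [/\ uniq s, (n * e < size s)%N & forall t, t \in s -> x + t *: b \in J]).
Proof.
move=> J0 sJ HJ.
have [P [P0 sP PJ]] := exists_vanishing_poly (leq_trans sJ (leq_card_bmultinom n e)).
by move/eqP: P0; apply; apply: (vanishing_poly_eq0 J0 HJ).
Qed.

End PolynomialMethod.

Require Import Defs.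
From mathcomp Require Import finmap.
From mathcomp Require Import all_classical all_reals all_analysis.
Import Order.TTheory GRing.Theory Num.Theory.
Local Open Scope fset_scope.
Local Open Scope classical_set_scope.
Local Open Scope ring_scope.

(** * Counting joints by deleting poor lines *)

Section JointsBound.
Context {F : fieldType} {n : nat}.
Implicit Types (T LL S : {fset set 'rV[F]_n}) (J : {fset 'rV[F]_n}).
Implicit Types (x : 'rV[F]_n) (l : set 'rV[F]_n).

Definition joint_of T x : Prop :=
  exists S, [/\ (S `<=` T)%fset, meet_at S x & directions_span S].

Lemma exists_poor_line T J e :
    J != fset0 -> (#|` J| < e.+1 ^ n)%N -> (forall x, x \in J -> joint_of T x) ->
  exists2 l, l \in T & (#|` [fset x in J | `[< l x >]]%fset| <= n * e)%N.
Proof.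
move=> J0 sJ HJ; apply: contrapT => rich.
apply: (@PolynomialMethod.rich_directions_false F n e (enum_fset J)) => //.
move=> x xJ; have [S [ST Sx [d dS dspan]]] := HJ _ xJ.
exists [seq d l | l <- enum_fset S] => // _ /mapP[l lS ->].
have lJ : (n * e < #|` [fset x in J | `[< l x >]]%fset|)%N.
  by rewrite ltnNge; apply/negP => lJ; apply: rich; exists l => //; apply: (fsubsetP ST).
have [_ [v lE]] := dS _ lS; have lx := Sx _ lS.
move: (d l) lE => b lE {dS dspan lS}; subst l; have [t0 _ xE] := lx.
(* Points off the line get the parameter 0, so that [choice] gives a function on all points. *)
have param y : exists t, y \in [fset z in J | `[< line_through v b z >]]%fset ->
    y = x + t *: b.
  have [[t _ yE]|yl] := pselect (line_through v b y).
    exists (t - t0) => _; rewrite -yE -xE -addrA -scalerDl; congr (_ + _ *: _).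
    by rewrite addrC subrK.
  by exists 0; rewrite !inE => /andP[_ /asboolP].
have [f fE] := choice param.
exists (map f (enum_fset [fset z in J | `[< line_through v b z >]]%fset)).
split; last 2 first.
- by rewrite size_map.
- by move=> _ /mapP[y yJ ->]; rewrite -fE //; move: yJ; rewrite !inE => /andP[].
rewrite map_inj_in_uniq ?fset_uniq // => y z yJ zJ fyz.
by rewrite (fE _ yJ) (fE _ zJ) fyz.
Qed.

(** Delete a poor line, losing at most n e points, and induct on the number of lines. *)
Lemma card_joints_le T J e :
    (#|` J| < e.+1 ^ n)%N -> (forall x, x \in J -> joint_of T x) ->
  (#|` J| <= n * e * #|` T|)%N.
Proof.
move: {2}(#|` T|) (leqnn #|` T|) => k; elim: k T J => [|k IH] T J Tk sJ HJ.
  have [-> | J0] := eqVneq J fset0; first by rewrite cardfs0.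
  have [l lT _] := exists_poor_line J0 sJ HJ.
  by move: Tk; rewrite leqn0 cardfs_eq0 => /eqP T0; rewrite T0 in lT.
have [-> | J0] := eqVneq J fset0; first by rewrite cardfs0.
have [l lT lJ] := exists_poor_line J0 sJ HJ.
pose J' := (J `\` [fset x in J | `[< l x >]])%fset.
have J'J : (J' `<=` J)%fset by exact: fsubsetDl.
have cT : #|` T| = (#|` (T `\ l)%fset|).+1 by rewrite (cardfsD1 l T) lT.
have lJJ : ([fset x in J | `[< l x >]] `<=` J)%fset.
  by apply/fsubsetP => x; rewrite !inE => /andP[].
rewrite -(cardfsID [fset x in J | `[< l x >]]%fset J) (fsetIidPr lJJ).
rewrite cT mulnS leq_add //; apply: IH.
- by move: Tk; rewrite cT.
- exact: leq_ltn_trans (fsubset_leq_card J'J) sJ.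
(* A remaining point is off [l], so its spanning lines survive the deletion. *)
move=> x; rewrite !inE => /andP[xl xJ]; move: xl; rewrite xJ /= => xl.
have [S [ST Sx dS]] := HJ _ xJ; exists S; split => //.
apply/fsubsetP => h hS; rewrite !inE (fsubsetP ST _ hS) andbT.
by apply: contra xl => /eqP <-; apply/asboolP; exact: Sx hS.
Qed.

(** With [e] the integer part of the n-th root of |J|, one has |J| ^ n <= (n e |T|) ^ n <= |J| (n
    |T|) ^ n, and a factor |J| cancels. *)
Lemma joints_bound T J : (1 < n)%N -> (forall x, x \in J -> joint_of T x) ->
  (#|` J| ^ n.-1 <= (n * #|` T|) ^ n)%N.
Proof.
move=> n1 HJ; have n0 := ltnW n1.
have [e eJ Je] : exists2 e, (e ^ n <= #|` J|)%N & (#|` J| < e.+1 ^ n)%N.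
  have ex : exists e, (#|` J| < e.+1 ^ n)%N.
    exists #|` J|; apply: (@leq_trans (#|` J|.+1 ^ 1)); first by rewrite expn1.
    by rewrite leq_pexp2l.
  case: (ex_minnP ex) => -[|e] He Hmin; first by exists 0%N => //; rewrite exp0n.
  by exists e.+1 => //; rewrite leqNgt; apply/negP => /Hmin; rewrite ltnn.
have [J0|J0] := posnP #|` J|.
  by rewrite J0 exp0n // -subn1 subn_gt0.
have := card_joints_le Je HJ; rewrite -(leq_exp2r _ _ n0) => JT.
rewrite -(leq_pmul2l J0) -expnS prednK //; apply: leq_trans JT _.
by rewrite -mulnA mulnCA expnMn leq_mul2r eJ orbT.
Qed.

(** * Points on many lines, by sampling *)

Definition lines_at LL x : {fset set 'rV[F]_n} := [fset l in LL | `[< l x >]]%fset.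

Lemma lines_at_sub LL x : (lines_at LL x `<=` LL)%fset.
Proof. by apply/fsubsetP => l; rewrite !inE => /andP[]. Qed.

Lemma exists_fsubset_card (K : choiceType) (A : {fset K}) k : (k <= #|` A|)%N ->
  exists2 B, (B `<=` A)%fset & #|` B| = k.
Proof.
move=> kA; exists [fset x in take k (enum_fset A)]%fset.
  by apply/fsubsetP => x; rewrite !inE => /mem_take.
by rewrite card_fseq undup_id ?take_uniq ?fset_uniq // size_takel.
Qed.

Definition generic LL : Prop :=
  forall S x, (S `<=` LL)%fset -> #|` S| = n -> meet_at S x -> directions_span S.

Lemma generic_joint LL T x : generic LL -> (T `<=` LL)%fset ->
  (n <= #|` lines_at T x|)%N -> joint_of T x.
Proof.
move=> gLL TL /exists_fsubset_card[S Sx Sn]; have ST := fsubset_trans Sx (lines_at_sub _ _).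
have mS : meet_at S x.
  by move=> l /(fsubsetP Sx); rewrite !inE => /andP[_ /asboolP].
by exists S; split => //; apply: gLL Sn mS; apply: fsubset_trans TL.
Qed.

(** For k < n ^ 2 the joints bound applies directly. Otherwise lines are sampled with m + 1 equal to
    k / n ^ 2 rounded down. The constant 32 n ^ 3 collects 4 for the points lost, 4 for the size of
    the sample, n from [joints_bound] and 2 n ^ 2 from the rounding. *)
Lemma card_rich_joints LL J k : (1 < n)%N -> generic LL ->
    (n <= k)%N -> (forall x, x \in J -> (k <= #|` lines_at LL x|)%N) ->
  (#|` J| ^ n.-1 * k ^ n <= (32 * n ^ 3 * #|` LL|) ^ n)%N.
Proof.
move=> n1 gLL nk Jk; have n0 := ltnW n1.
have [knn|nnk] := ltnP k (n * n).
  have JL : (#|` J| ^ n.-1 <= (n * #|` LL|) ^ n)%N.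
    apply: joints_bound => // x xJ; apply: generic_joint gLL _ _ => //.
    exact: leq_trans nk (Jk _ xJ).
  have kn : (k ^ n <= (n * n) ^ n)%N by rewrite leq_exp2r // ltnW.
  apply: leq_trans (leq_mul JL kn) _; rewrite -expnMn leq_exp2r //.
  by rewrite !expnS expn0; nia.
have m0 : (0 < k %/ (n * n))%N by rewrite divn_gt0 // muln_gt0 n0.
pose m := (k %/ (n * n)).-1; have mE : m.+1 = (k %/ (n * n))%N by rewrite prednK.
pose inc (x : J) := fsub LL (lines_at LL (val x)).
have [|S [mS JS]] := @exists_sample LL m J inc n n0.
  move=> x; rewrite card_fsub ?lines_at_sub // mE mulnA mulnC.
  exact: leq_trans (leq_divM _ _) (Jk _ (valP x)).
pose T := [fsetval l in S]%fset; have TL : (T `<=` LL)%fset.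
  by apply/fsubsetP => l /imfsetP[h _ ->]; exact: valP.
have ST : S = fsub LL T by rewrite FSetK.
have cT : #|` T| = #|S| by rewrite ST card_fsub.
pose J' := [fset x in J | (n <= #|` lines_at T x|)%N]%fset.
have J'J : (J' `<=` J)%fset by apply/fsubsetP => x; rewrite !inE => /andP[].
have cJ' : #|[set x | (n <= #|inc x :&: S|)%N]%SET| = #|` J'|.
  rewrite -(card_fsub J'J); apply: eq_card => x; rewrite !inE (valP x) /=.
  congr (_ <= _)%N; rewrite -(@card_fsub _ LL) ?(fsubset_trans (lines_at_sub _ _)) //.
  apply: eq_card => l; rewrite {1}ST !inE (valP l) /=.
  by rewrite andbC.
have J'T : (#|` J'| ^ n.-1 <= (n * #|` T|) ^ n)%N.
  apply: joints_bound => // x; rewrite !inE => /andP[_ nx].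
  exact: generic_joint gLL TL nx.
have km : (k <= 2 * (n * n) * m.+1)%N.
  have := divn_eq k (n * n); have := ltn_pmod k (_ : 0 < n * n)%N.
  by rewrite muln_gt0 n0 mE => /(_ isT); move: m0; nia.
have JJ' : (#|` J| ^ n.-1 <= (4 * #|` J'|) ^ n.-1)%N.
  by rewrite leq_exp2r -?subn1 ?subn_gt0 // cardfE -cJ'.
have J4 : ((4 * #|` J'|) ^ n.-1 <= (4 * (n * #|` T|)) ^ n)%N.
  by rewrite (expnMn 4 #|` J'|) (expnMn 4 (n * _)) leq_mul // leq_pexp2l ?leq_pred.
apply: leq_trans (leq_mul (leq_trans JJ' J4) (_ : _ <= (2 * (n * n) * m.+1) ^ n)%N) _.
  by rewrite leq_exp2r.
rewrite -expnMn leq_exp2r // cT.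
have := leq_mul (leqnn (8 * n ^ 3)%N) mS.
have -> : (8 * n ^ 3 * (m.+1 * #|S|) =
    4 * (n * #|S|) * (2 * (n * n) * m.+1))%N by rewrite !expnS expn0; lia.
move=> XL; apply: leq_trans XL _; rewrite -cardfE; apply: eq_leq.
by move: (n ^ 3)%N #|` LL| => a b; lia.
Qed.

Lemma ffact_leq_expn k m : (k ^_ m <= k ^ m)%N.
Proof. by elim: m => // m IH; rewrite ffactnSr expnSr leq_mul // leq_subr. Qed.

(** The tuples counted are n-element subsets of the r lines through [x], and the binomial
    coefficient of n among r is at most r ^ n. *)
Lemma multiplicity_le LL x : (multiplicity LL x <= #|` lines_at LL x| ^ n)%N.
Proof.
set A := lines_at LL x; suff mA : (multiplicity LL x <= 'C(#|` A|, n))%N.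
  apply: leq_trans mA (leq_trans _ (ffact_leq_expn _ _)).
  by rewrite -bin_ffact leq_pmulr // fact_gt0.
rewrite /multiplicity; set D := [fset S in _ | _]%fset.
have DA S : S \in D -> (S `<=` A)%fset /\ #|` S| = n.
  rewrite !inE fpowersetE => /andP[SL /and3P[/eqP Sn /asboolP Sx _]]; split => //.
  by apply/fsubsetP => l lS; rewrite !inE (fsubsetP SL _ lS); apply/asboolP; exact: Sx lS.
rewrite (cardfE A) -card_draws cardE -(size_map (fsub A)); apply: uniq_leq_size.
  rewrite map_inj_in_uniq ?fset_uniq // => S1 S2 /DA[S1A _] /DA[S2A _].
  exact: fsub_inj.
move=> _ /mapP[S /DA[SA Sn] ->]; rewrite mem_enum inE card_fsub //; exact/eqP.
Qed.

End JointsBound.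

(** * Summation over dyadic ranges *)

Lemma powR_natX (R : realType) (a : R) (k : nat) (q : R) : 0 <= a ->
  (a ^+ k) `^ q = a `^ (k%:R * q).
Proof. by move=> a0; rewrite powRrM powR_mulrn. Qed.

Theorem corollary7p0p11 (R : realType) (n : nat) (hn : (2 <= n)%N) :
  exists C : R,
    forall (F : fieldType) (LL : {fset set 'rV[F]_n}),
      (forall l, l \in LL -> is_line l) ->
      (forall (S : {fset set 'rV[F]_n}) (x : 'rV[F]_n),
          (S `<=` LL)%fset -> #|` S| = n -> meet_at S x ->
          directions_span S) ->
      \sum_(x \in joint_set LL)
          ((multiplicity LL x)%:R : R) `^ (1 / (n%:R - 1))
        <= C * ln (#|` LL|%:R) * #|` LL|%:R `^ (n%:R / (n%:R - 1)).
Proof.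
(* The bound on rich joints gives (32 n ^ 3) ^ n; the factor 2 ^ n pays for passing from 2 ^ i to 2
   ^ (i + 1) within a dyadic range. *)
pose c := ((2 * (32 * n ^ 3)) ^ n)%N.
set q : R := 1 / (n%:R - 1).
have n1E : n%:R - 1 = n.-1%:R :> R by rewrite -[1]/(1%:R) -natrB ?subn1 // ltnW.
have n1_gt0 : 0 < n.-1%:R :> R by rewrite ltr0n -subn1 subn_gt0.
have q_ge0 : 0 <= q by rewrite /q n1E div1r invr_ge0 ltW.
have n1q : n.-1%:R * q = 1 by rewrite /q n1E div1r divff // gt_eqF.
have powq (a b : nat) : (a <= b)%N -> (a%:R : R) `^ q <= b%:R `^ q.
  by move=> ab; rewrite ge0_ler_powR ?nnegrE ?ler0n ?ler_nat.
(* For L >= 2 there are at most 2 ln L / ln 2 dyadic ranges. *)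
exists (2 / ln 2 * c%:R `^ q) => F LL _ gLL.
set L := #|` LL|.
rewrite fsbig_finite; last exact: finite_joint_set.
set J := fset_set (joint_set LL).
have nJ x : x \in J -> (n <= #|` lines_at LL x|)%N.
  rewrite in_fset_set; last exact: finite_joint_set.
  rewrite inE => -[S [SL nS Sx _]]; apply: leq_trans nS (fsubset_leq_card _).
  by apply/fsubsetP => l lS; rewrite !inE (fsubsetP SL _ lS); apply/asboolP; exact: Sx lS.
have rL x : (#|` lines_at LL x| <= L)%N by apply/fsubset_leq_card/lines_at_sub.
(* With fewer than two lines there is no joint, and the right-hand side is 0: ln 1 = 0, and [ln] is
   0 at 0 by convention. *)
have [L1|L2] := ltnP L 2.
  rewrite big_seq big1 => [|x /nJ nx]; last first.
    by have := leq_trans hn (leq_trans nx (rL x)); rewrite leqNgt L1.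
  have -> : ln (L%:R : R) = 0.
    by case: L L1 {rL} => [|[|]] // _; rewrite ?ln1 // ln0.
  by rewrite mulr0 mul0r.
pose K := trunc_log 2 L.
pose w i : R := ((2 ^ i.+1) ^ n)%N%:R `^ q.
pose rich i := [fset x in J | (2 ^ i <= #|` lines_at LL x|)%N]%fset.
(* Only the term whose index is the integer part of log2 r is used; the others are nonnegative. *)
have levelwise x : x \in J -> (multiplicity LL x)%:R `^ q <=
    \sum_(i < K.+1) (2 ^ i <= #|` lines_at LL x|)%N%:R * w i.
  move=> xJ; set r := #|` lines_at LL x|.
  have r0 : (0 < r)%N by apply: leq_trans (nJ _ xJ); exact: ltnW.
  have iK : (trunc_log 2 r < K.+1)%N by rewrite ltnS leq_trunc_log // rL.
  rewrite (bigD1 (Ordinal iK)) //= trunc_logP // mul1r.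
  apply: ler_wpDr.
    by apply: sumr_ge0 => i _; rewrite mulr_ge0 ?ler0n // powR_ge0.
  apply: powq; apply: leq_trans (multiplicity_le _ _) _.
  by rewrite leq_exp2r ?(ltnW hn) // ltnW // trunc_log_ltn.
(* Since (n - 1) q = 1, this is the q-th power of the bound on rich joints. *)
have weak i : #|` rich i|%:R * w i <= c%:R `^ q * L%:R `^ (n%:R / (n%:R - 1)).
  have -> : (n%:R / (n%:R - 1) : R) = n%:R * q by rewrite /q mulrA mulr1.
  have -> : (#|` rich i|%:R : R) = (#|` rich i| ^ n.-1)%N%:R `^ q.
    by rewrite natrX powR_natX // n1q powRr1.
  rewrite -powR_natX // -!natrX -!powRM // -!natrM; apply: powq.
  (* [card_rich_joints] asks for k >= n; every joint lies on at least n lines, so 2 ^ i may be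
     raised to n. *)
  have nk : (n <= maxn n (2 ^ i))%N by exact: leq_maxl.
  have Jk x : x \in rich i -> (maxn n (2 ^ i) <= #|` lines_at LL x|)%N.
    by rewrite !inE => /andP[/nJ nx ix]; rewrite geq_max nx.
  have := card_rich_joints hn gLL nk Jk; rewrite -/L => richL.
  have {richL} : (#|` rich i| ^ n.-1 * (2 ^ i) ^ n <= (32 * n ^ 3 * L) ^ n)%N.
    by apply: leq_trans richL; rewrite leq_mul2l leq_exp2r ?leq_maxr ?orbT // ltnW.
  rewrite -(leq_pmul2l (_ : 0 < 2 ^ n)%N) ?expn_gt0 // => richL.
  by rewrite /c expnS expnMn mulnCA -(expnMn _ L) -mulnA expnMn.
apply: (@le_trans _ _ (\sum_(i < K.+1) #|` rich i|%:R * w i)).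
  rewrite big_seq; apply: le_trans (ler_sum _ levelwise) _.
  rewrite -big_seq exchange_big /=; apply: ler_sum => i _.
  rewrite -mulr_suml ler_wpM2r ?powR_ge0 // -natr_sum ler_nat.
  rewrite card_fset_sum1 /rich big_fset /= [leqRHS]big_mkcond.
  by apply: leq_sum => x _; case: ifP.
apply: (@le_trans _ _ (\sum_(i < K.+1) c%:R `^ q * L%:R `^ (n%:R / (n%:R - 1)))).
  by apply: ler_sum => i _; exact: weak.
rewrite sumr_const card_ord -[leLHS]mulr_natl.
have L0 : 0 < L%:R :> R by rewrite ltr0n ltnW.
have ln2 : 0 < ln 2 :> R by rewrite ln_gt0 // ltr1n.
have lnL : ln 2 <= ln L%:R :> R by rewrite ler_ln ?posrE ?ler_nat.
have Kln : K%:R * ln 2 <= ln L%:R :> R.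
  rewrite mulr_natl -lnXn // ler_ln ?posrE ?exprn_gt0 // -natrX ler_nat.
  by rewrite trunc_logP // ltnW.
rewrite [2 / ln 2 * _ * _]mulrAC -[leRHS]mulrA ler_wpM2r ?mulr_ge0 ?powR_ge0 //.
rewrite mulrAC ler_pdivlMr // -natr1 mulrDl mul1r.
by apply: le_trans (lerD Kln lnL) _; rewrite mulr_natl mulr2n.
Qed.
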